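(* For any integer $\ell\geq 4$ there exists a graph $G$ with an edge $e$ such that $\gamma_g'(G)=\ell$ and $\gamma_g'(G-e)=\ell+2$.
   Context: Graphs are finite, simple and undirected. A vertex dominates itself and all its neighbors. The domination game on a graph $G$ is played by two players, Dominator and Staller, who alternately choose a vertex of $G$ such that each chosen vertex dominates at least one vertex that was not dominated by the previously chosen vertices. The game ends when all vertices of $G$ are dominated. Dominator wants the total number of chosen vertices to be as small as possible, Staller wants it to be as large as possible. Assuming both play optimally, $\gamma_g'(G)$ (the Staller-start game domination number) is the total number of vertices chosen when Staller moves first. $G-e$ denotes the graph obtained from $G$ by removing the edge $e$ (keeping all vertices). *)

(* Defs.v *)
From mathcomp Require Import all_boot.
Set Implicit Arguments.
Unset Strict Implicit.
Unset Printing Implicit Defensive.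

Record sgraph := SGraph {
  vertex :> finType;
  adj : rel vertex;
  adj_sym : symmetric adj;
  adj_irr : irreflexive adj
}.

Definition edges (G : sgraph) : {set {set G}} :=
  [set [set p.1; p.2] | p : G * G & adj p.1 p.2].

Section EdgeDeletion.
Variables (G : sgraph) (e : {set G}).

Definition del_adj : rel G := fun x y => adj x y && ([set x; y] != e).

Lemma del_adj_sym : symmetric del_adj.
Proof. by move=> x y; rewrite /del_adj adj_sym setUC. Qed.

Lemma del_adj_irr : irreflexive del_adj.
Proof. by move=> x; rewrite /del_adj adj_irr. Qed.

Definition del_edge : sgraph := SGraph del_adj_sym del_adj_irr.
End EdgeDeletion.

Inductive player := Dominator | Staller.

Definition opponent (p : player) : player :=
  if p is Dominator then Staller else Dominator.

Lemma bigminn_leq (I : finType) (P : pred I) (F : I -> nat) d j :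
  P j -> \big[minn/d]_(i | P i) F i <= F j.
Proof.
move=> Pj; elim: (index_enum I) (mem_index_enum j) => //= i r IH.
rewrite inE big_cons => /predU1P[<-|/IH le_r]; first by rewrite Pj geq_minl.
by case: ifP => // _; apply: leq_trans (geq_minr _ _) le_r.
Qed.

Section DominationGame.
Variable G : sgraph.
Implicit Types (p : player) (S : {set G}) (v : G).

Definition closed_nbhd v : {set G} := [set u | (u == v) || adj v u].

Definition dominated S : {set G} := \bigcup_(v in S) closed_nbhd v.

(* [S] is the set of vertices chosen so far. *)
Definition legal S v : bool := ~~ (closed_nbhd v \subset dominated S).

Definition game_over S : bool := dominated S == [set: G].

(* The number of moves still to be played from position [S] when [p] is to
   move and both players play optimally. The fuel [n] is sufficient as soon as
   it bounds the number of undominated vertices (see [remaining_movesE]). The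
   default value [#|G|] of the minimum is harmless: while the game is not over
   some move is legal, and no game has more than [#|G|] moves (see
   [Dominator_optimal]). *)
Fixpoint minimax (n : nat) p S : nat :=
  if n is n'.+1 then
    if game_over S then 0
    else (match p with
          | Dominator =>
              \big[minn/#|G|]_(v | legal S v) minimax n' Staller (v |: S)
          | Staller =>
              \max_(v | legal S v) minimax n' Dominator (v |: S)
          end).+1
  else 0.

Definition remaining_moves p S : nat := minimax #|G| p S.

(* Staller-start game domination number *)
Definition gamma_g' : nat := remaining_moves Staller set0.

Lemma dominatedU1 v S : dominated (v |: S) = closed_nbhd v :|: dominated S.
Proof. by rewrite /dominated bigcup_setU big_set1. Qed.

Lemma legal_undominated S v :
  legal S v -> #|~: dominated (v |: S)| < #|~: dominated S|.
Proof.
move=> Lv; apply: proper_card; rewrite dominatedU1 setCU.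
rewrite properE subsetIr /=; apply: contra Lv => /subsetP sub.
apply/subsetP => u uv; apply: contraLR uv => uS.
by have := sub u; rewrite !inE uS => /(_ isT) /andP[].
Qed.

Lemma legal_exists S : ~~ game_over S -> exists v, legal S v.
Proof.
rewrite /game_over -subTset => /subsetPn[v _ vS]; exists v.
by apply/subsetPn; exists v; rewrite // inE eqxx.
Qed.

Lemma game_over_card S : game_over S = (#|~: dominated S| <= 0).
Proof. by rewrite leqn0 cards_eq0 -(inj_eq (@setC_inj _)) setCK setC0. Qed.

Lemma minimax_fuel m n p S :
  #|~: dominated S| <= m -> #|~: dominated S| <= n ->
  minimax m p S = minimax n p S.
Proof.
elim: m n p S => [|m IH] [|n] p S hm hn //=.
- by rewrite game_over_card hm.
- by rewrite game_over_card hn.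
case: ifP => // _; congr _.+1.
have step q v : legal S v -> minimax m q (v |: S) = minimax n q (v |: S).
  move=> /legal_undominated Lv.
  by apply: IH; rewrite -ltnS (leq_trans Lv).
by case: p; apply: eq_bigr => v; apply: step.
Qed.

Lemma remaining_movesE p S :
  remaining_moves p S =
    if game_over S then 0
    else (match p with
          | Dominator =>
              \big[minn/#|G|]_(v | legal S v) remaining_moves Staller (v |: S)
          | Staller =>
              \max_(v | legal S v) remaining_moves Dominator (v |: S)
          end).+1.
Proof.
have -> : remaining_moves p S = minimax #|G|.+1 p S.
  by apply: minimax_fuel; rewrite ?leqW ?max_card.
by [].
Qed.

Lemma remaining_moves_bound p S : remaining_moves p S <= #|~: dominated S|.
Proof.
have [n] := ubnP #|~: dominated S|; elim: n p S => // n IH p S hn.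
rewrite remaining_movesE; case: ifPn => // nov.
have step q v : legal S v -> remaining_moves q (v |: S) < #|~: dominated S|.
  move=> /legal_undominated Lv.
  exact: leq_ltn_trans (IH _ _ (leq_trans Lv hn)) Lv.
have [v0 L0] := legal_exists nov.
case: p.
  exact: leq_ltn_trans (bigminn_leq _ _ L0) (step _ _ L0).
elim/big_ind: _ => [|a b ha hb|v]; first exact: leq_ltn_trans (step Staller _ L0).
  by rewrite gtn_max ha.
exact: step.
Qed.

Lemma Dominator_optimal S : ~~ game_over S ->
  (exists2 v, legal S v &
    remaining_moves Dominator S = (remaining_moves Staller (v |: S)).+1) /\
  (forall v, legal S v ->
    remaining_moves Dominator S <= (remaining_moves Staller (v |: S)).+1).
Proof.
move=> nov; have [v0 L0] := legal_exists nov.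
rewrite remaining_movesE (negbTE nov).
have lb v : legal S v ->
    \big[minn/#|G|]_(w | legal S w) remaining_moves Staller (w |: S)
      <= remaining_moves Staller (v |: S).
  exact: bigminn_leq.
split; last by move=> v Lv; rewrite ltnS lb.
case: (arg_minnP (fun v => remaining_moves Staller (v |: S)) L0) => v Lv vmin.
exists v => //; congr _.+1; apply/eqP; rewrite eqn_leq lb //=.
elim/big_ind: _ => [|a b ha hb|w Lw]; last exact: vmin.
- exact: leq_trans (remaining_moves_bound _ _) (max_card _).
- by rewrite leq_min ha.
Qed.

Lemma Staller_optimal S : ~~ game_over S ->
  (exists2 v, legal S v &
    remaining_moves Staller S = (remaining_moves Dominator (v |: S)).+1) /\
  (forall v, legal S v ->
    (remaining_moves Dominator (v |: S)).+1 <= remaining_moves Staller S).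
Proof.
move=> nov; have [v0 L0] := legal_exists nov.
rewrite remaining_movesE (negbTE nov); split; last first.
  by move=> v Lv; rewrite ltnS (bigD1 v) //= leq_maxl.
have [|v Lv ->] := @eq_bigmax_cond _ (legal S)
  (fun v => remaining_moves Dominator (v |: S)); last by exists v.
by apply/card_gt0P; exists v0.
Qed.

End DominationGame.

(* Main.v *)
Require Import Defs.
From mathcomp Require Import all_boot.

(** Two disjoint isolated vertices lengthen the game by exactly two moves: each
    of them is a pass, and whenever the opponent passes a player may answer with
    the other pass. Hence it suffices to treat l = 4 and l = 5. There take
    G = H + K2 + K1, where H is the 5-cycle, respectively the ladder P2 x P4,
    and e the edge of K2. As K2 is itself a pass, deleting e changes the number
    of passes from two to three; an odd number of passes lets Staller force
    Dominator to start on H, where the Dominator-start game is longer by one than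
    the Staller-start game. *)

Set Implicit Arguments.
Unset Strict Implicit.
Unset Printing Implicit Defensive.

(** * Upper bounds on the game length *)

Section RemainingMovesLeq.
Variable G : sgraph.
Implicit Types (S : {set G}) (p : player) (v : G).

Lemma game_overPn S : reflect (exists v, legal S v) (~~ game_over S).
Proof.
apply: (iffP idP) => [|[v]]; first exact: legal_exists.
by apply: contra => /eqP ov; rewrite ov subsetT.
Qed.

Lemma remaining_moves_leq0 p S : (remaining_moves p S <= 0) = game_over S.
Proof. by rewrite remaining_movesE; case: ifP. Qed.

(** Bounds are easier to compare than values: Dominator's turn becomes an existential and Staller's
    a universal statement, free of minima and their default. A finished position needs its own
    disjunct here, since it offers no move to exhibit. *)
Lemma Dominator_leqP S k :
  reflect (game_over S \/
           exists2 v, legal S v & remaining_moves Staller (v |: S) <= k)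
          (remaining_moves Dominator S <= k.+1).
Proof.
apply: (iffP idP) => [|[ov|[v Lv le_v]]]; last first.
- have /Dominator_optimal[_ le_w] : ~~ game_over S by apply/game_overPn; exists v.
  exact: leq_trans (le_w v Lv) _.
- by rewrite remaining_movesE ov.
have [ov|/Dominator_optimal[[w Lw ->] _]] := boolP (game_over S); first by left.
by rewrite ltnS; right; exists w.
Qed.

Lemma Staller_leqP S k :
  reflect (forall v, legal S v -> remaining_moves Dominator (v |: S) <= k)
          (remaining_moves Staller S <= k.+1).
Proof.
apply: (iffP idP) => [le_k v Lv|le_k].
  have /Staller_optimal[_ ge_w] : ~~ game_over S by apply/game_overPn; exists v.
  exact: leq_trans (ge_w v Lv) le_k.
have [ov|/Staller_optimal[[w Lw ->] _]] := boolP (game_over S).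
  by rewrite remaining_movesE ov.
by rewrite ltnS le_k.
Qed.

End RemainingMovesLeq.

(** * Adding two isolated vertices *)

Section TwoPasses.
(** The adjacency is only constrained by hypotheses, so that the results apply both to a sum graph
    and to that graph after the deletion of an edge. *)
Variables (G : sgraph) (r : rel (G + bool)%type).
Hypotheses (r_sym : symmetric r) (r_irr : irreflexive r).
Hypothesis r_inl : forall x y, r (inl x) (inl y) = adj x y.
Hypothesis r_inr : forall c z, r (inr c) z = false.
Let H := SGraph r_sym r_irr.
Implicit Types (T : {set G}) (C : {set bool}) (p : player).

Definition passed C T : {set H} :=
  [set z : G + bool | match z with inl x => x \in T | inr c => c \in C end].

Lemma passedU_inl C T v : inl v |: passed C T = passed C (v |: T).
Proof. by apply/setP=> -[x|c]; rewrite !inE. Qed.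

Lemma passedU_inr C T c : inr c |: passed C T = passed (c |: C) T.
Proof. by apply/setP=> -[x|d]; rewrite !inE. Qed.

Lemma dominated_passed C T : dominated (passed C T) = passed C (dominated T).
Proof.
apply/setP=> z; apply/bigcupP/idP => [[[v|c]]|]; rewrite !inE.
- move=> vT; case: z => [x|c]; rewrite /= ?r_inl; last by rewrite r_sym r_inr.
  by move=> xv; apply/bigcupP; exists v; rewrite // !inE.
- by move=> cC; rewrite /= r_inr orbF => /eqP->.
case: z => [x /bigcupP[v vT]|c cC].
  by rewrite inE => xv; exists (inl v); rewrite !inE //= r_inl.
by exists (inr c); rewrite !inE ?eqxx.
Qed.

Lemma legal_passed_inl C T v : legal (passed C T) (inl v) = legal T v.
Proof.
rewrite /legal dominated_passed; congr (~~ _).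
apply/subsetP/subsetP => sub z; last first.
  case: z => [x|c]; rewrite !inE /=; last by rewrite r_sym r_inr.
  by rewrite r_inl => xv; apply: sub; rewrite inE.
by move=> zv; have := sub (inl z); rewrite !inE /= r_inl; apply; move: zv; rewrite inE.
Qed.

Lemma legal_passed_inr C T c : legal (passed C T) (inr c) = (c \notin C).
Proof.
rewrite /legal dominated_passed; congr (~~ _).
apply/subsetP/idP => [sub|cC z]; first by have := sub (inr c); rewrite !inE eqxx; apply.
by rewrite !inE /= r_inr orbF => /eqP->.
Qed.

Lemma game_over_passed C T :
  game_over (passed C T) = game_over T && (C == setT).
Proof.
rewrite /game_over dominated_passed; apply/eqP/andP => [/setP E|[/eqP-> /eqP->]].
  split; apply/eqP/setP=> x; first by have := E (inl x); rewrite !inE.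
  by have := E (inr x); rewrite !inE.
by apply/setP=> -[x|c]; rewrite !inE.
Qed.

Lemma both_passed_leq k p T :
  (remaining_moves p (passed setT T) <= k) = (remaining_moves p T <= k).
Proof.
elim: k p T => [|k IH] p T.
  by rewrite !remaining_moves_leq0 game_over_passed eqxx andbT.
case: p.
  apply/Dominator_leqP/Dominator_leqP; rewrite game_over_passed eqxx andbT.
    case=> [|[[v|c]]]; [by left| |by rewrite legal_passed_inr inE].
    by rewrite legal_passed_inl passedU_inl IH; right; exists v.
  case=> [|[v Lv le_v]]; [by left|right].
  by exists (inl v); rewrite ?legal_passed_inl // passedU_inl IH.
apply/Staller_leqP/Staller_leqP => le_k.
  by move=> v Lv; rewrite -IH -passedU_inl le_k // legal_passed_inl.
move=> [v|c]; last by rewrite legal_passed_inr inE.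
by rewrite legal_passed_inl passedU_inl IH; apply: le_k.
Qed.

(** Each isolated vertex can be dominated only by itself, so two moves are still due whatever
    happens on [G]. *)
Lemma not_passed_gt1 p T : (remaining_moves p (passed set0 T) <= 1) = false.
Proof.
have not_over z : game_over (z |: passed set0 T) = false.
  have E (C : {set bool}) c : c \notin C -> (C == setT) = false.
    by move=> cC; apply: contraNF cC => /eqP->.
  case: z => [v|c]; rewrite ?passedU_inl ?passedU_inr game_over_passed andbC.
    by rewrite (E _ true) ?inE.
  by rewrite (E _ (~~ c)) ?inE //; case: c.
apply/negP; case: p.
  move/Dominator_leqP=> [|[z _]]; last by rewrite remaining_moves_leq0 not_over.
  by rewrite game_over_passed andbC; case: eqP => // /setP/(_ true); rewrite !inE.
move/Staller_leqP/(_ (inr true)).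
by rewrite legal_passed_inr inE remaining_moves_leq0 not_over => /(_ isT).
Qed.

Lemma legal_other_pass c T : legal (passed [set c] T) (inr (~~ c)).
Proof. by rewrite legal_passed_inr inE; case: c. Qed.

Lemma other_passU c T : inr (~~ c) |: passed [set c] T = passed setT T.
Proof.
by rewrite passedU_inr; congr passed; apply/setP=> -[]; rewrite !inE; case: c.
Qed.

Lemma Dominator_answers_pass k c T :
  remaining_moves Staller T <= k ->
  remaining_moves Dominator (passed [set c] T) <= k.+1.
Proof.
move=> le_k; apply/Dominator_leqP; right; exists (inr (~~ c)).
  exact: legal_other_pass.
by rewrite other_passU both_passed_leq.
Qed.

Lemma Staller_answers_pass k c T :
  remaining_moves Staller (passed [set c] T) <= k.+1 ->
  remaining_moves Dominator T <= k.
Proof.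
move/Staller_leqP/(_ _ (legal_other_pass c T)).
by rewrite other_passU both_passed_leq.
Qed.

(** This covers a Dominator who must pass because [G] is finished: the other pass is then the only
    move left. *)
Lemma last_pass_leq k c T :
  game_over T -> remaining_moves Staller (passed [set c] T) <= k.+1.
Proof.
move=> ov; apply/Staller_leqP => -[v|d].
  by rewrite legal_passed_inl => Lv; case/game_overPn: ov; exists v.
rewrite legal_passed_inr inE => dc.
have -> : d = ~~ c by case: d c dc => -[].
by rewrite other_passU both_passed_leq remaining_movesE ov.
Qed.

(** From left to right, Staller answers a pass by the other pass and otherwise plays as on [G]. From
    right to left, Dominator does the same, and starts passing himself only when [G] is finished. *)
Lemma not_passed_leq k p T :
  (remaining_moves p (passed set0 T) <= k.+2) = (remaining_moves p T <= k).
Proof.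
elim: k p T => [|k IH] p T; apply/idP/idP; case: p.
- case/Dominator_leqP=> [|[[v|c] _]].
  + by rewrite game_over_passed remaining_moves_leq0 => /andP[].
  + by rewrite passedU_inl not_passed_gt1.
  + by rewrite passedU_inr setU0; apply: Staller_answers_pass.
(* A legal move of Staller on [G] would leave both passes to be played in a single move. *)
- move/Staller_leqP=> le1; rewrite remaining_moves_leq0; apply/negPn/game_overPn.
  case=> v Lv; have := le1 (inl v).
  by rewrite legal_passed_inl passedU_inl not_passed_gt1 => /(_ Lv).
- rewrite remaining_moves_leq0 => ov; apply/Dominator_leqP; right.
  exists (inr true); first by rewrite legal_passed_inr inE.
  by rewrite passedU_inr setU0 last_pass_leq.
- move=> le0; apply/Staller_leqP=> -[v|c].
    rewrite legal_passed_inl; move: le0; rewrite remaining_moves_leq0 => ov Lv.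
    by case/game_overPn: ov; exists v.
  by rewrite passedU_inr setU0 => _; apply: Dominator_answers_pass.
- case/Dominator_leqP=> [|[[v|c]]].
  + by rewrite game_over_passed remaining_movesE => /andP[->].
  + rewrite legal_passed_inl passedU_inl IH => Lv le_k.
    by apply/Dominator_leqP; right; exists v.
  + by rewrite passedU_inr setU0 => _; apply: Staller_answers_pass.
- move/Staller_leqP=> le_k; apply/Staller_leqP=> v Lv; rewrite -IH -passedU_inl.
  by rewrite le_k ?legal_passed_inl.
- case/Dominator_leqP=> [ov|[v Lv le_k]]; apply/Dominator_leqP; right.
    exists (inr true); first by rewrite legal_passed_inr inE.
    by rewrite passedU_inr setU0 last_pass_leq.
  by exists (inl v); rewrite ?legal_passed_inl // passedU_inl IH.
- move=> le_k; apply/Staller_leqP=> -[v|c].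
    rewrite legal_passed_inl passedU_inl IH => Lv.
    by move/Staller_leqP: le_k; apply.
  by rewrite passedU_inr setU0 => _; apply: Dominator_answers_pass.
Qed.

Lemma gamma_g'_two_passes : gamma_g' H = gamma_g' G + 2.
Proof.
have Hle k : (gamma_g' H <= k.+2) = (gamma_g' G <= k).
  rewrite -not_passed_leq; congr (remaining_moves _ _ <= _).
  by apply/setP=> -[x|c]; rewrite !inE.
(* [Hle] only speaks of bounds from 2 on, so the lengths 0 and 1 are excluded separately. *)
have gt1 : 1 < gamma_g' H.
  rewrite ltnNge -[X in ~~ (X <= 1)]/(remaining_moves _ _).
  suff <- : passed set0 set0 = set0 by rewrite not_passed_gt1.
  by apply/setP=> -[x|c]; rewrite !inE.
rewrite addn2; apply/eqP; rewrite eqn_leq Hle leqnn /=.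
by case: (gamma_g' H) gt1 Hle => [|[|m]] // _ Hle; rewrite !ltnS -Hle.
Qed.

End TwoPasses.

(** * Evaluating the game on lists of numbers *)

Section ListGame.
Variables (n : nat) (r : rel 'I_n) (r_sym : symmetric r) (r_irr : irreflexive r).
Let G := SGraph r_sym r_irr.
Variable nbhd : rel nat.
Hypothesis nbhdE : forall u v : 'I_n, nbhd u v = (u == v) || r u v.

(* [U] lists the undominated vertices; a game that is not over when the fuel [k]
   runs out counts as a failure. *)
Fixpoint ends_within k p (U : seq nat) : bool :=
  if U is [::] then true
  else if k is k'.+1 then
    match p with
    | Dominator =>
        has (fun v => has (nbhd v) U &&
               ends_within k' Staller [seq u <- U | ~~ nbhd v u]) (iota 0 n)
    | Staller =>
        all (fun v => has (nbhd v) U ==>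
               ends_within k' Dominator [seq u <- U | ~~ nbhd v u]) (iota 0 n)
    end
  else false.

(** The rest of the game depends on the position only through this list, and lists of numbers
    evaluate well, unlike finite sets. *)
Definition undominated (S : {set G}) : seq nat :=
  [seq val u | u <- enum 'I_n & u \notin dominated S].

Lemma closed_nbhdE (u v : G) : (u \in closed_nbhd v) = nbhd (val v) (val u).
Proof. by rewrite inE nbhdE eq_sym. Qed.

Lemma undominatedU1 S (v : G) :
  undominated (v |: S) = [seq u <- undominated S | ~~ nbhd (val v) u].
Proof.
rewrite /undominated filter_map; congr map.
rewrite -[RHS]filter_predI; apply: eq_filter => u.
by rewrite dominatedU1 inE negb_or closed_nbhdE.
Qed.

Lemma legal_undominatedE S (v : G) : legal S v = has (nbhd (val v)) (undominated S).
Proof.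
apply/subsetPn/hasP => [[u uv uS]|[_ /mapP[u + ->]]].
  exists (val u); last by rewrite -closed_nbhdE.
  by apply/mapP; exists u; rewrite // mem_filter uS mem_enum.
by rewrite mem_filter -closed_nbhdE => /andP[uS _] uv; exists u.
Qed.

Lemma game_over_undominated S : game_over S = (undominated S == [::]).
Proof.
apply/eqP/eqP => [ov|U0].
  rewrite /undominated (_ : [seq _ <- _ | _] = [::]) //.
  by apply/eqP; rewrite -[_ == _]negbK -has_filter; apply/hasPn=> u _; rewrite ov inE.
apply/setP=> u; rewrite inE; apply/negPn/negP => uS.
suff: val u \in undominated S by rewrite U0.
by apply/mapP; exists u; rewrite // mem_filter uS mem_enum.
Qed.

Lemma ends_withinE k p S :
  (remaining_moves p S <= k) = ends_within k p (undominated S).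
Proof.
elim: k p S => [|k IH] p S.
  by rewrite remaining_moves_leq0 game_over_undominated; case: undominated.
have [ov|nov] := boolP (game_over S).
  rewrite remaining_movesE ov; move: ov; rewrite game_over_undominated.
  by move/eqP->.
(* The fixpoint matches on the list first, so it unfolds only once the list is known to be
   nonempty. *)
have -> q : ends_within k.+1 q (undominated S) =
  if q is Dominator then
    has (fun v => has (nbhd v) (undominated S) &&
      ends_within k Staller [seq u <- undominated S | ~~ nbhd v u]) (iota 0 n)
  else
    all (fun v => has (nbhd v) (undominated S) ==>
      ends_within k Dominator [seq u <- undominated S | ~~ nbhd v u]) (iota 0 n).
  by move: nov; rewrite game_over_undominated; case: (undominated S).
rewrite -val_enum_ord; case: p.
  apply/Dominator_leqP/hasP => [[ov|[v Lv]]|[_ /mapP[v _ ->] /andP[Lv]]].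
  - by rewrite ov in nov.
  - rewrite IH undominatedU1 => le_k; exists (val v); first exact/map_f/mem_enum.
    by rewrite -legal_undominatedE Lv.
  - by rewrite -undominatedU1 -IH => le_k; right; exists v; rewrite // legal_undominatedE.
apply/Staller_leqP/allP => [le_k _ /mapP[v _ ->]|le_k v Lv].
  rewrite -legal_undominatedE -undominatedU1 -IH; apply/implyP; exact: le_k.
have /le_k : val v \in [seq val u | u <- enum 'I_n] by exact/map_f/mem_enum.
by rewrite -legal_undominatedE Lv IH undominatedU1.
Qed.

Lemma gamma_g'_ends_within k :
  ends_within k.+1 Staller (iota 0 n) -> ~~ ends_within k Staller (iota 0 n) ->
  gamma_g' G = k.+1.
Proof.
have U0 : undominated set0 = iota 0 n.
  rewrite /undominated -val_enum_ord; congr map; apply/all_filterP/allP => u _.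
  by rewrite /dominated big_set0 inE.
by rewrite -U0 -!ends_withinE -ltnNge => le_k gt_k; apply/eqP; rewrite eqn_leq le_k.
Qed.

End ListGame.

(** * Graphs given by lists of edges *)

Section EdgeList.
Implicit Types (E : seq (nat * nat)).

(** Symmetrizing and discarding loops makes every list define a simple graph. *)
Definition edge_rel E : rel nat :=
  fun u v => (u != v) && (((u, v) \in E) || ((v, u) \in E)).

Lemma edge_rel_sym E : symmetric (edge_rel E).
Proof. by move=> u v; rewrite /edge_rel eq_sym orbC. Qed.

Lemma edge_rel_irr E : irreflexive (edge_rel E).
Proof. by move=> u; rewrite /edge_rel eqxx. Qed.

Definition edge_graph n E : sgraph :=
  @SGraph 'I_n (fun u v => edge_rel E u v)
    (fun u v => edge_rel_sym E u v) (fun u => edge_rel_irr E u).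

Definition edge_nbhd E : rel nat := fun u v => (u == v) || edge_rel E u v.

Lemma eq_set2 (T : finType) (u v i j : T) : u != v ->
  ([set u; v] == [set i; j]) = ((u, v) == (i, j)) || ((v, u) == (i, j)).
Proof.
move=> uv; rewrite !xpair_eqE; apply/eqP/orP => [E|[]/andP[/eqP-> /eqP->] //].
  have: u \in [set i; j] by rewrite -E !inE eqxx.
  have: v \in [set i; j] by rewrite -E !inE eqxx orbT.
  rewrite !inE; move: uv => /[swap] /orP[]/eqP-> /[swap] /orP[]/eqP->.
  - by rewrite eqxx.
  - by right; rewrite !eqxx.
  - by left; rewrite !eqxx.
  - by rewrite eqxx.
by rewrite setUC.
Qed.

(** Deleting the edge drops the head of the list; the hypothesis excludes a second copy of it, in
    either orientation, in the tail. *)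
Lemma del_edge_rel n E (i j u v : 'I_n) : ~~ edge_rel E i j ->
  @del_adj (edge_graph n ((val i, val j) :: E)) [set i; j] u v = edge_rel E u v.
Proof.
move=> Eij; have [<-{v}|uv] := eqVneq u v; first by rewrite /del_adj /= !edge_rel_irr.
rewrite /del_adj /=; move: Eij; have [|] := boolP ([set u; v] == [set i; j]).
  rewrite andbF eq_set2 // => /orP[]/eqP[<- <-] /negPf Euv.
    by rewrite Euv.
  by rewrite edge_rel_sym Euv.
rewrite eq_set2 // => /norP[/negPf Nuv /negPf Nvu] _.
(* Ordinals are compared through their values, so [Nuv] and [Nvu] convert to facts on pairs of
   numbers. *)
rewrite andbT /edge_rel !inE (Nuv : ((val u, val v) == (val i, val j)) = false).
by rewrite (Nvu : ((val v, val u) == (val i, val j)) = false).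
Qed.

(** Each of the two game numbers is pinned down by one bound that holds and one that fails, which
    leaves four closed boolean tests. *)
Lemma edge_list_gap n E k i j :
  i < n -> j < n -> i != j -> ~~ edge_rel E i j ->
  let N := edge_nbhd ((i, j) :: E) in
  let N' := edge_nbhd E in
  ends_within n N k.+1 Staller (iota 0 n) ->
  ~~ ends_within n N k Staller (iota 0 n) ->
  ends_within n N' k.+3 Staller (iota 0 n) ->
  ~~ ends_within n N' k.+2 Staller (iota 0 n) ->
  exists (G : sgraph) (e : {set G}),
    [/\ e \in edges G, gamma_g' G = k.+1 & gamma_g' (del_edge e) = k.+3].
Proof.
move=> lt_i lt_j ij Eij N N' le_k gt_k le_k' gt_k'.
pose u := Ordinal lt_i; pose v := Ordinal lt_j.
exists (edge_graph n ((i, j) :: E)), [set u; v]; split.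
- by apply/imsetP; exists (u, v); rewrite // inE /= /edge_rel ij inE eqxx.
- exact: gamma_g'_ends_within le_k gt_k.
- apply: gamma_g'_ends_within le_k' gt_k' => x y.
  by rewrite (del_edge_rel (i := u) (j := v)).
Qed.

End EdgeList.

(** * Lifting the gap by two and concluding *)

Lemma two_passes_gap (G : sgraph) (e : {set G}) : e \in edges G ->
  exists (H : sgraph) (f : {set H}),
    [/\ f \in edges H, gamma_g' H = gamma_g' G + 2
      & gamma_g' (del_edge f) = gamma_g' (del_edge e) + 2].
Proof.
pose r : rel (G + bool) :=
  fun y z => if (y, z) is (inl u, inl v) then adj u v else false.
have r_sym : symmetric r by move=> [u|c] [v|d] //=; apply: adj_sym.
have r_irr : irreflexive r by move=> [u|c] //=; apply: adj_irr.
move=> /imsetP[[u v]]; rewrite inE /= => uv ->.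
exists (SGraph r_sym r_irr), (inl @: [set u; v]); split.
- by apply/imsetP; exists (inl u, inl v); rewrite ?inE //= imsetU1 imset_set1.
- exact: gamma_g'_two_passes.
- apply: (@gamma_g'_two_passes (del_edge [set u; v])) => [x y|[]//].
  rewrite /del_adj /=; congr (_ && ~~ _).
  (* Adding the passes commutes with the deletion: by injectivity of [inl], a pair has the deleted
     edge as its image only if it is the deleted edge of [G]. *)
  rewrite -[RHS](inj_eq (imset_inj (@inl_inj G bool))).
  by congr (_ == _); rewrite imsetU1 imset_set1.
Qed.

Theorem proposition2p5 (l : nat) (hl : 4 <= l) :
  exists (G : sgraph) (e : {set G}),
    [/\ e \in edges G, gamma_g' G = l & gamma_g' (del_edge e) = l + 2].
Proof.
(* Passes preserve the parity of [l], hence the two base cases 4 and 5. *)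
elim/ltn_ind: l hl => -[|[|[|[|[|[|l]]]]]] IH // _.
(* The vertices 0 to 4 form the 5-cycle, 5 and 6 span the edge to delete, and 7 is isolated. *)
- by apply: (@edge_list_gap 8 [:: (0, 1); (1, 2); (2, 3); (3, 4); (4, 0)] 3 5 6);
    lazy.
(* The ladder has the sides 0 to 3 and 4 to 7; the edge to delete joins 8 and 9, and 10 is
   isolated. *)
- by apply: (@edge_list_gap 11 [:: (0, 1); (1, 2); (2, 3); (4, 5); (5, 6); (6, 7);
      (0, 4); (1, 5); (2, 6); (3, 7)] 4 8 9); lazy.
have [//|//|G [e [eG gG gGe]]] := IH l.+4.
have [H [f [fH gH gHf]]] := two_passes_gap eG.
by exists H, f; rewrite fH gH gHf gG gGe !addn2.
Qed.
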